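(* Let $\mu\in\mathcal{P}(\mathcal{X})$ be such that $h_\mu$ attains its minimum on $\mathcal{X}$. Then, for fixed $\mu$, the minimum of $u\mapsto J'_\mu(u)$ over $u\in\mathcal{P}(\mathcal{X})$ is attained at the Dirac measure at a minimizer of $h_\mu$: $$\delta_{x^*(\mu)}\in\arg\min_{u\in\mathcal{P}(\mathcal{X})}J'_\mu(u)\qquad\text{for every }x^*(\mu)\in\arg\min_{x\in\mathcal{X}}h_\mu(x).$$
   Context: $\mathcal{X}$ is a nonempty compact subset of $\mathbb{R}^d$, $\mathcal{P}(\mathcal{X})$ is the set of Borel probability measures on $\mathcal{X}$, $\delta_x$ is the Dirac measure at $x$, and $J:\mathcal{P}(\mathcal{X})\to\mathbb{R}$. The influence function of $J$ at $\mu$ is $h_\mu(x)=\lim_{t\to0^+}\frac1t\{J(\mu+t(\delta_x-\mu))-J(\mu)\}$, $x\in\mathcal{X}$. The von Mises derivative of $J$ at $\mu$ is $J'_\mu(\nu)=\lim_{t\to0^+}\frac1t\{J(\mu+t(\nu-\mu))-J(\mu)\}$, $\nu\in\mathcal{P}(\mathcal{X})$; it exists at $\mu$ if these limits exist and there is a measurable $\phi_\mu:\mathcal{X}\to\mathbb{R}$, integrable with respect to every $\nu\in\mathcal{P}(\mathcal{X})$, with $J'_\mu(\nu)=\int\phi_\mu\,\mathrm{d}(\nu-\mu)$ for all $\nu\in\mathcal{P}(\mathcal{X})$. Standing assumption: the von Mises derivative of $J$ exists at $\mu$. *)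

(* Defs.v *)
From HB Require Import structures.
From mathcomp Require Import all_boot all_order all_algebra.
From mathcomp Require Import all_classical all_reals all_analysis.

Set Implicit Arguments.
Unset Strict Implicit.
Unset Printing Implicit Defensive.

Import Order.TTheory GRing.Theory Num.Theory.
Import numFieldNormedType.Exports.

Local Open Scope classical_set_scope.
Local Open Scope ring_scope.

(** A nonempty subset [X] of a topological space as a space of its own, with the
    subspace topology.  Nonemptiness is carried along because every
    [measurableType] is pointed; the chosen point plays no other role. *)
Definition subspace_of {T : topologicalType} (X : set T) (X0 : X !=set0) : Type :=
  set_type X.

Section subspace_of.
Context {T : topologicalType} (X : set T) (X0 : X !=set0).

HB.instance Definition _ :=
  Topological.copy (subspace_of X0) (set_type X).
HB.instance Definition _ := isPointed.Build (subspace_of X0)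
  (exist _ (projT1 (cid X0)) (mem_set (projT2 (cid X0)))).

End subspace_of.

Definition borel {T : topologicalType} (X : set T) (X0 : X !=set0) :=
  g_sigma_algebraType (@open (subspace_of X0)).

HB.instance Definition _ {T : topologicalType} (X : set T) (X0 : X !=set0) :=
  Measurable.on (borel X0).

Section mixture.
Context d (T : measurableType d) (R : realType).
Variables (mu nu : probability T R) (t : {i01 R}).

Definition mixture : set T -> \bar R :=
  measure_add (mscale (1 - t%:num)%:nng mu) (mscale t%:num%:nng nu).

HB.instance Definition _ := Measure.on mixture.

Lemma mixtureE A :
  mixture A = ((1 - t%:num)%:E * mu A + t%:num%:E * nu A)%E.
Proof. by rewrite /mixture measure_addE. Qed.

Let mixture_setT : mixture setT = 1%E.
Proof. by rewrite mixtureE !probability_setT !mule1 -EFinD subrK. Qed.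

HB.instance Definition _ := Measure_isProbability.Build _ _ _ mixture mixture_setT.

End mixture.

Section clamp01.
Context {R : realType} (t : R).

Let clamp01_subproof : 0 <= Num.max 0 (Num.min 1 t) <= 1.
Proof. by rewrite le_max lexx ge_max ler01 ge_min lexx. Qed.

Definition clamp01 : {i01 R} :=
  Itv01 (proj1 (andP clamp01_subproof)) (proj2 (andP clamp01_subproof)).

End clamp01.

Section von_mises.
Context d (T : measurableType d) (R : realType).
Implicit Types (mu nu : probability T R).

(** [mu + t (nu - mu)] is a probability measure only for [t] in [0, 1]; other
    [t] are clamped to [0, 1], which does not affect limits as [t --> 0^'+]. *)
Definition segment mu nu (t : R) : probability T R := mixture mu nu (clamp01 t).

(** The library's measures carry (irrelevant) values on nonmeasurable sets; the
    functionals [J] below are not required to ignore them. *)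
Variable J : probability T R -> R.

Definition diff_quotient mu nu (t : R) : R :=
  t^-1 * (J (segment mu nu t) - J mu).

Definition influence mu (x : T) : R :=
  lim (diff_quotient mu \d_x t @[t --> 0^'+]).

Definition von_mises mu nu : R :=
  lim (diff_quotient mu nu t @[t --> 0^'+]).

(** The integral of [phi] against the signed measure [nu - mu] is the difference
    of the integrals against [nu] and [mu], both finite by integrability. *)
Definition von_mises_exists mu : Prop :=
  [/\ forall x : T, cvg (diff_quotient mu \d_x t @[t --> 0^'+]),
      forall nu, cvg (diff_quotient mu nu t @[t --> 0^'+]) &
      exists phi : T -> R,
        [/\ measurable_fun setT phi,
            forall nu, nu.-integrable setT (EFin \o phi) &
            forall nu,
              von_mises mu nu = \int[nu]_x phi x - \int[mu]_x phi x]].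

End von_mises.

Definition argmin {T : Type} {R : realType} (f : T -> R) : set T :=
  [set x | forall y, f x <= f y].

(* Main.v *)
(** Evaluating [J'_mu] at a Dirac measure shows that [h_mu] is the density [phi_mu]
    up to the additive constant [\int phi_mu dmu], so a minimizer of [h_mu]
    minimizes [phi_mu]; the mean of [phi_mu] under any probability measure is at
    least that minimum, which is its mean under the Dirac measure there. *)
Require Import Defs.
From HB Require Import structures.
From mathcomp Require Import all_boot all_order all_algebra.
From mathcomp Require Import all_classical all_reals all_analysis.
From mathcomp Require Import measurable_realfun.

Set Implicit Arguments.
Unset Strict Implicit.
Unset Printing Implicit Defensive.

Import Order.TTheory GRing.Theory Num.Theory.
Import numFieldNormedType.Exports.

Local Open Scope classical_set_scope.
Local Open Scope ring_scope.

Lemma Rintegral_dirac d (T : measurableType d) (R : realType) (x : T)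
    (f : T -> R) :
  measurable_fun setT f -> \int[\d_x]_y f y = f x.
Proof.
move=> mf; rewrite /Rintegral integral_dirac//; last exact/measurable_EFinP.
by rewrite diracT mul1e.
Qed.

(** Total mass 1 makes the constant [c] its own mean; monotonicity of the integral then applies. *)
Lemma le_Rintegral_probability d (T : measurableType d) (R : realType)
    (P : probability T R) (f : T -> R) (c : R) :
  P.-integrable setT (EFin \o f) -> (forall y, c <= f y) ->
  c <= \int[P]_y f y.
Proof.
move=> intf cf.
have <- : \int[P]_(_ in setT) c = c.
  by rewrite Rintegral_cst// [X in fine X](probability_setT P) mulr1.
apply: le_Rintegral => //.
exact: finite_measure_integrable_cst.
Qed.

Theorem lemma5 (R : realType) (d : nat) (X : set 'rV[R]_d)
    (X0 : X !=set0) (cX : compact X)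
    (J : probability (borel X0) R -> R) (mu : probability (borel X0) R)
    (Jmu : von_mises_exists J mu)
    (hmin : argmin (influence J mu) !=set0) :
  forall xstar : borel X0, argmin (influence J mu) xstar ->
    argmin (von_mises J mu) \d_xstar.
Proof.
move=> xstar minx nu.
case: Jmu => _ _ [phi [mphi intphi vmE]].
have infE y : influence J mu y = phi y - \int[mu]_x phi x.
  (* Once [phi y] is a Dirac integral, [vmE] applies at [\d_y]; [influence J mu y] and
     [von_mises J mu \d_y] unfold to the same limit. *)
  by rewrite -(Rintegral_dirac y mphi) -vmE.
(* The common mean under [mu] cancels, leaving [phi xstar] to be bounded by the mean of [phi] under
   [nu]. *)
rewrite !vmE lerD2r Rintegral_dirac//.
apply: le_Rintegral_probability => // y.
by have := minx y; rewrite !infE lerD2r.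
Qed.
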